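(* Let $\mu=\mathfrak C+l_1+l_2$ be a curved symmetric differential graded Lie algebra structure on a graded vector space $E=\oplus_{i\in\mathbb Z}E_i$ and let $\pi\in E_0$. Let $S:E\to E$ be the Euler map, $S(X)=-|X|X$ for homogeneous $X$. Then $\mathcal N=\pi+S$ is a Nijenhuis vector valued form (with curvature $\pi$) with respect to $\mu$ with square $2\pi+S$ if and only if $\pi$ is a Poisson element, i.e. $l_2(\pi,\pi)=0$. In this case, the deformed structure $[\mathcal N,\mu]_{_{RN}}$ is the curved symmetric differential graded Lie algebra structure $(\mathfrak C+l_1(\pi))+(l_1+l_2(\pi,\cdot))+l_2$ on $E$.
   Context: Base field $\mathbb K=\mathbb R$ or $\mathbb C$; $|X|$ is the degree of a homogeneous $X\in E$. A symmetric vector valued $k$-form ($k\ge 0$) is a graded symmetric $k$-linear map $K:E\times\cdots\times E\to E$ (for $k=0$, an element of $E$). It has degree $\bar K$ if $|K(X_1,\dots,X_k)|=|X_1|+\cdots+|X_k|+\bar K$ (for $X\in E$, $\bar X=|X|$). A symmetric vector valued form is a formal sum $\sum_{k\ge0}K_k$ of vector valued $k$-forms; it has degree $d$ if all $K_k$ do. Insertion: for a $k$-form $K$ and an $l$-form $L$ with $l\ge1$, $$\iota_KL(X_1,\dots,X_{k+l-1})=\sum_{\sigma\in Sh(k,l-1)}\epsilon(\sigma)L(K(X_{\sigma(1)},\dots,X_{\sigma(k)}),X_{\sigma(k+1)},\dots,X_{\sigma(k+l-1)}),$$ where $Sh(k,l-1)$ is the set of $(k,l-1)$-unshuffles and $\epsilon(\sigma)$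 is the Koszul sign; $\iota_KL=0$ if $L\in E$; and $\iota_XK=K(X,\cdot,\dots,\cdot)$ for $X\in E$. Richardson-Nijenhuis bracket: $[K,L]_{_{RN}}=\iota_KL-(-1)^{\bar K\bar L}\iota_LK$, extended to formal sums. A curved symmetric differential graded Lie algebra structure is a sum $\mathfrak C+l_1+l_2$ with $\mathfrak C\in E_1$ (the curvature, possibly zero), $l_1$ a linear map of degree $1$, and $l_2$ a graded symmetric bilinear map of degree $1$, such that for all homogeneous $X,Y,Z$: $l_1(\mathfrak C)=0$; $l_2(\mathfrak C,X)+l_1(l_1(X))=0$; $l_1(l_2(X,Y))+l_2(l_1(X),Y)+(-1)^{|X|}l_2(X,l_1(Y))=0$; and $l_2(l_2(X,Y),Z)+(-1)^{|Y||Z|}l_2(l_2(X,Z),Y)+(-1)^{|X|(|Y|+|Z|)}l_2(l_2(Y,Z),X)=0$. For a form $\mu$ of degree $1$, a form $\mathcal N$ of degree zero is Nijenhuis with respect to $\mu$ with square $\mathcal K$ if $\mathcal K$ is a vector valued form of degree zero with $[\mathcal N,[\mathcal N,\mu]_{_{RN}}]_{_{RN}}=[\mathcal K,\mu]_{_{RN}}$ and $[\mathcal N,\mathcal K]_{_{RN}}=0$. ''With curvature'' means that $\mathcal N$ has a vector valued $0$-form component. *)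

(* Defs.v *)
From mathcomp Require Import all_boot all_order all_algebra.
From mathcomp Require Import perm.
From mathcomp Require Import boolp classical_sets functions cardinality fsbigop.
From mathcomp Require Import reals.
From mathcomp Require Import complex.

Set Implicit Arguments.
Unset Strict Implicit.
Unset Printing Implicit Defensive.

Import Order.TTheory GRing.Theory Num.Theory.

Local Open Scope classical_set_scope.
Local Open Scope ring_scope.

Variant base_field := RealBase | ComplexBase.

Definition scalars (R : realType) (b : base_field) : numFieldType :=
  match b with
  | RealBase => R
  | ComplexBase => R[i]
  end.

Definition decomposes (K : numFieldType) (E : lmodType K)
    (P : int -> set E) (x : E) (c : int -> E) : Prop :=
  [/\ forall i, P i (c i),
      finite_set [set i | c i != 0]
    & x = \sum_(i \in [set: int]) c i].

(* The internal direct sum of the subspaces [piece i], i : int. *)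
Record graded_space (K : numFieldType) := GradedSpace {
  total :> lmodType K;
  piece : int -> set total;
  piece_zero : forall i, piece i 0;
  piece_linear : forall i (a : K) x y,
    piece i x -> piece i y -> piece i (a *: x + y);
  piece_direct : forall x, exists! c, decomposes piece x c
}.

Section Forms.
Variables (K : numFieldType) (E : graded_space K).

Definition hcomp (i : int) (x : E) : E := sval (cid (piece_direct x)) i.

Definition euler (x : E) : E := \sum_(i \in [set: int]) (- i%:~R) *: hcomp i x.

Definition homogeneous n (d : n.-tuple int) (X : n.-tuple E) : Prop :=
  forall i : 'I_n, piece (tnth d i) (tnth X i).

Definition permute T n (s : 'S_n) (X : n.-tuple T) : n.-tuple T :=
  [tuple tnth X (s i) | i < n].

(* The Koszul sign: X_s(1) ... X_s(n) = koszul d s * X_1 ... X_n in the graded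
   symmetric algebra, when X_i has degree d_i.  Each inversion of s costs the
   sign of one transposition. *)
Definition koszul n (d : n.-tuple int) (s : 'S_n) : K :=
  \prod_(i < n) \prod_(j < n | (i < j)%N && (s j < s i)%N)
    (-1) ^ (tnth d (s i) * tnth d (s j)).

(* A formal sum of k-ary maps, k >= 0, is a single map on finite sequences; its
   k-ary component is the restriction to the sequences of size k. *)
Definition vform := seq E -> E.

Definition multilinear (F : vform) : Prop :=
  forall (s t : seq E) (a : K) (x y : E),
    F (s ++ (a *: x + y) :: t) = a *: F (s ++ x :: t) + F (s ++ y :: t).

Definition graded_symmetric (F : vform) : Prop :=
  forall n (d : n.-tuple int) (X : n.-tuple E) (s : 'S_n),
    homogeneous d X -> F (permute s X) = koszul d s *: F X.

Definition has_degree (m : int) (F : vform) : Prop :=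
  forall n (d : n.-tuple int) (X : n.-tuple E),
    homogeneous d X -> piece (\sum_(i < n) tnth d i + m) (F X).

Definition vector_valued_form (m : int) (F : vform) : Prop :=
  [/\ multilinear F, graded_symmetric F & has_degree m F].

Definition form0 (x : E) : vform := fun s => if s is [::] then x else 0.
Definition form1 (f : E -> E) : vform := fun s => if s is [:: x] then f x else 0.
Definition form2 (f : E -> E -> E) : vform :=
  fun s => if s is [:: x; y] then f x y else 0.

Definition unshuffle n (k : nat) (s : 'S_n) : bool :=
  [forall i : 'I_n, forall j : 'I_n,
    ((i < j)%N && ((j < k)%N || (k <= i)%N)) ==> (s i < s j)%N].

(* The n-ary component of the insertion of F into G on homogeneous arguments of
   degrees d.  The k-ary component of F goes with the (n - k + 1)-ary component
   of G, so the 0-ary component of G never contributes. *)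
Definition insertion_homog (F G : vform) n (d : n.-tuple int) (X : n.-tuple E)
    : E :=
  \sum_(k < n.+1) \sum_(s : 'S_n | unshuffle k s)
    koszul d s *: G (F (take k (permute s X)) :: drop k (permute s X)).

(* Koszul signs only make sense for homogeneous arguments; the formula is
   extended multilinearly, by splitting every argument into its homogeneous
   components.  The sum has finite support when F and G are multilinear. *)
Definition insertion (F G : vform) : vform := fun X =>
  \sum_(d \in [set: (size X).-tuple int])
    insertion_homog F G d [tuple hcomp (tnth d i) (tnth (in_tuple X) i) | i < size X].

(* The degrees f of F and g of G are explicit arguments, since the zero form
   has every degree. *)
Definition RN_bracket (f g : int) (F G : vform) : vform :=
  insertion F G \- (fun X => (-1) ^ (f * g) *: insertion G F X).

Record curved_sdgla (C : E) (l1 : E -> E) (l2 : E -> E -> E) : Prop := {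
  curvature_degree : piece 1 C;
  l1_linear : forall (a : K) x y, l1 (a *: x + y) = a *: l1 x + l1 y;
  l1_degree : forall i x, piece i x -> piece (i + 1) (l1 x);
  l2_linear_l : forall (a : K) x y z,
    l2 (a *: x + y) z = a *: l2 x z + l2 y z;
  l2_linear_r : forall (a : K) x y z,
    l2 z (a *: x + y) = a *: l2 z x + l2 z y;
  l2_symmetric : forall i j x y, piece i x -> piece j y ->
    l2 x y = (-1) ^ (i * j) *: l2 y x;
  l2_degree : forall i j x y, piece i x -> piece j y ->
    piece (i + j + 1) (l2 x y);
  l1_curvature : l1 C = 0;
  l1_square : forall i x, piece i x -> l2 C x + l1 (l1 x) = 0;
  l1_derivation : forall i j x y, piece i x -> piece j y ->
    l1 (l2 x y) + l2 (l1 x) y + (-1) ^ i *: l2 x (l1 y) = 0;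
  l2_jacobi : forall i j k x y z, piece i x -> piece j y -> piece k z ->
    l2 (l2 x y) z + (-1) ^ (j * k) *: l2 (l2 x z) y
      + (-1) ^ (i * (j + k)) *: l2 (l2 y z) x = 0
}.

Definition curved_form (C : E) (l1 : E -> E) (l2 : E -> E -> E) : vform :=
  form0 C \+ form1 l1 \+ form2 l2.

Record nijenhuis_with_square (mu N Q : vform) : Prop := {
  structure_form : vector_valued_form 1 mu;
  nijenhuis_form : vector_valued_form 0 N;
  square_form : vector_valued_form 0 Q;
  nijenhuis_square :
    RN_bracket 0 1 N (RN_bracket 0 1 N mu) =1 RN_bracket 0 1 Q mu;
  nijenhuis_commute : RN_bracket 0 0 N Q =1 (fun=> 0)
}.

Definition form_curvature (F : vform) : E := F [::].

Definition poisson_element (l2 : E -> E -> E) (p : E) : Prop :=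
  piece 0 p /\ l2 p p = 0.

End Forms.

(* Main.v *)
(* For a vector valued form F of degree m one has [p + S, F] = i_p F + m F,
   because bracketing with the Euler map S multiplies F by its degree.  Hence
   [N, [N, mu]] = mu + 2 i_p mu + i_p i_p mu, whereas
   [2 p + S, mu] = mu + 2 i_p mu, and the two differ by
   i_p i_p mu = l2(p, p).  That the deformed structure is again curved follows
   from the Jacobi identity; evaluating it and the derivation rule at (p, p)
   produces factors 2, which are invertible. *)
Require Import Defs.
From mathcomp Require Import all_boot all_order all_algebra.
From mathcomp Require Import perm.
From mathcomp Require Import boolp classical_sets functions cardinality fsbigop.
From mathcomp Require Import reals.
From mathcomp Require Import complex.

Set Implicit Arguments.
Unset Strict Implicit.
Unset Printing Implicit Defensive.

Import Order.TTheory GRing.Theory Num.Theory.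

Local Open Scope ring_scope.

(** * Homogeneous components and the Euler map *)

Section GradedSpace.
Variables (K : numFieldType) (E : graded_space K).
Implicit Types (x y : E) (i : int).

Lemma pieceD i x y : piece i x -> piece i y -> piece i (x + y).
Proof. by move=> hx /(piece_linear 1 hx); rewrite scale1r. Qed.

Lemma pieceZ i (a : K) x : piece i x -> piece i (a *: x).
Proof. by move=> /piece_linear/(_ (piece_zero E i)) -/(_ a); rewrite addr0. Qed.

Lemma decomposes_hcomp x : decomposes (@piece K E) x (@hcomp K E ^~ x).
Proof. by rewrite /hcomp; case: cid => c []. Qed.

Lemma hcomp_piece i x : piece i (hcomp i x).
Proof. by case: (decomposes_hcomp x). Qed.

Lemma hcomp_unique x c : decomposes (@piece K E) x c -> c =1 @hcomp K E ^~ x.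
Proof. by move=> xc i; rewrite /hcomp; case: cid => /= c' [_ /(_ c xc) <-]. Qed.

Lemma hcomp_support x : exists2 r : seq int, uniq r &
  forall i, i \notin r -> hcomp i x = 0.
Proof.
case: (decomposes_hcomp x) => _ /finite_seqP[s defs] _.
exists (undup s) => [|i]; first exact: undup_uniq.
apply: contraNeq => xi; rewrite mem_undup.
by have : [set` s]%classic i by rewrite -defs.
Qed.

(** Sums over all degrees have finite support in an infinite index set; passing to a duplicate-free
    list that covers the support makes ordinary finite sums available. *)
Lemma fsum_support (V : nmodType) (T : choiceType) (r : seq T) (f : T -> V) :
    uniq r -> (forall t, t \notin r -> f t = 0) ->
  \sum_(t \in [set: T]) f t = \sum_(t <- r) f t.
Proof.
move=> ur f0; rewrite (@bigfs _ _ _ _ r xpredT) // => [|t _ /f0//].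
by apply: eq_fsbigl; apply/seteqP; split.
Qed.

Lemma hcomp_sum x (r : seq int) : uniq r ->
  (forall i, i \notin r -> hcomp i x = 0) -> \sum_(i <- r) hcomp i x = x.
Proof.
by move=> ur x0; rewrite -fsum_support//; case: (decomposes_hcomp x) => _ _ <-.
Qed.

Lemma hcomp_support2 x y : exists r : seq int, [/\ uniq r,
  forall i, i \notin r -> hcomp i x = 0 & forall i, i \notin r -> hcomp i y = 0].
Proof.
have [r _ xr] := hcomp_support x; have [s _ ys] := hcomp_support y.
exists (undup (r ++ s)); split=> [|i|i]; first exact: undup_uniq.
  by rewrite mem_undup mem_cat negb_or => /andP[/xr].
by rewrite mem_undup mem_cat negb_or => /andP[_ /ys].
Qed.

(** An element is the finite sum of its components, so additive identities need checking only in a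
    single degree. *)
Lemma graded_ind (P : E -> Prop) : P 0 ->
  (forall x y, P x -> P y -> P (x + y)) ->
  (forall i x, piece i x -> P x) -> forall x, P x.
Proof.
move=> P0 PD Ph x; have [r ur xr] := hcomp_support x.
rewrite -(hcomp_sum ur xr); apply: big_ind => // i _.
exact/Ph/hcomp_piece.
Qed.

(** By uniqueness of decompositions: combining the components of [x] and [y] degree by degree
    decomposes [a *: x + y]. *)
Lemma hcomp_linear i : linear (@hcomp K E i).
Proof.
move=> a x y; have [r [ur xr yr]] := hcomp_support2 x y.
rewrite -(@hcomp_unique (a *: x + y) (fun j => a *: hcomp j x + hcomp j y)) //.
have r0 j : j \notin r -> a *: hcomp j x + hcomp j y = 0.
  by move=> jr; rewrite xr// yr// scaler0 addr0.
split=> [j||].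
- by apply: piece_linear; apply: hcomp_piece.
- apply: (sub_finite_set (B := [set` r])) => [j /=|]; last exact: finite_seq.
  by apply: contraNT => /r0 ->.
- rewrite (fsum_support ur r0) big_split /= -scaler_sumr.
  by rewrite !hcomp_sum.
Qed.

Lemma hcomp_homog i j x : piece i x -> hcomp j x = if j == i then x else 0.
Proof.
move=> xi; rewrite -(@hcomp_unique x (fun j => if j == i then x else 0)) //.
split=> [k||].
- by case: eqP => [->|_] //; apply: piece_zero.
- apply: (sub_finite_set (B := [set i]%classic)) => [k /=|]; last exact: finite_set1.
  by have [//|_] := eqVneq k i; rewrite eqxx.
- rewrite (@fsum_support _ _ [:: i]) // => [|k].
    by rewrite big_seq1 eqxx.
  by rewrite inE => /negPf ->.
Qed.

Lemma euler_homog i x : piece i x -> euler x = - i%:~R *: x.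
Proof.
move=> xi; rewrite /euler (@fsum_support _ _ [:: i]) // => [|k].
  by rewrite big_seq1 (hcomp_homog _ xi) eqxx.
by rewrite inE (hcomp_homog _ xi) => /negPf ->; rewrite scaler0.
Qed.

Lemma euler_linear : linear (@euler K E).
Proof.
move=> a x y; have [r [ur xr yr]] := hcomp_support2 x y.
rewrite /euler !(fsum_support (r := r)) // => [|i ir|i ir|i ir].
- rewrite scaler_sumr -big_split; apply: eq_bigr => i _ /=.
  by rewrite hcomp_linear scalerDr !scalerA mulrC.
- by rewrite yr// scaler0.
- by rewrite xr// scaler0.
- by rewrite hcomp_linear xr// yr// scaler0 addr0 scaler0.
Qed.

Lemma euler_piece i x : piece i x -> piece i (euler x).
Proof. by move=> xi; rewrite (euler_homog xi); apply: pieceZ. Qed.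

Lemma linear_at0 (B : E -> E) : linear B -> B 0 = 0.
Proof. by move=> /(_ (-1) 0 0); rewrite scaler0 addr0 scaleN1r addNr. Qed.

Lemma linear_atD (B : E -> E) x y : linear B -> B (x + y) = B x + B y.
Proof. by move=> linB; rewrite -[x]scale1r linB !scale1r. Qed.

Lemma linear_bigsum (B : E -> E) (I : Type) (r : seq I) (f : I -> E) :
  linear B -> B (\sum_(i <- r) f i) = \sum_(i <- r) B (f i).
Proof.
move=> linB; apply: (big_morph B _ (linear_at0 linB)) => x y.
exact: linear_atD.
Qed.

(** Undoes the splitting of an argument into homogeneous components that is built into
    [insertion]. *)
Lemma fsum_hcomp1 (B : E -> E) x : linear B ->
  \sum_(d \in [set: 1.-tuple int]) B (hcomp (tnth d ord0) x) = B x.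
Proof.
move=> linB; have [r ur xr] := hcomp_support x.
rewrite (@fsum_support _ _ [seq [tuple i] | i <- r]).
- rewrite big_map -[in RHS](hcomp_sum ur xr) linear_bigsum //.
- by rewrite map_inj_uniq // => i j [].
- move=> d; case/tupleP: d => i t; rewrite (tuple0 t) => ir.
  rewrite xr; first exact: linear_at0.
  apply: contra ir => ir; apply/mapP; exists i => //; exact/val_inj.
Qed.

Lemma fsum_hcomp2 (B : E -> E -> E) x y :
    (forall z, linear (B^~ z)) -> (forall z, linear (B z)) ->
  \sum_(d \in [set: 2.-tuple int])
    B (hcomp (tnth d ord0) x) (hcomp (tnth d ord_max) y) = B x y.
Proof.
move=> linl linr; have [r [ur xr yr]] := hcomp_support2 x y.
rewrite (@fsum_support _ _ [seq [tuple i; j] | i <- r, j <- r]).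
- rewrite big_allpairs_dep -[in RHS](hcomp_sum ur xr) (linear_bigsum _ _ (linl y)).
  apply: eq_bigr => i _.
  by rewrite -[in RHS](hcomp_sum ur yr) (linear_bigsum _ _ (linr _)).
- by rewrite allpairs_uniq // => -[i j] [k l] _ _ [-> ->].
- move=> d; case/tupleP: d => i t; case/tupleP: t => j t; rewrite (tuple0 t) => ijr.
  have [ir|/xr ix] := boolP (i \in r); last first.
    by rewrite [hcomp _ x]ix; exact: (linear_at0 (linl _)).
  have [jr|/yr jy] := boolP (j \in r); last first.
    by rewrite [hcomp _ y]jy; exact: (linear_at0 (linr _)).
  case/negP: ijr; apply/allpairsP; exists (i, j); split=> //; exact/val_inj.
Qed.

End GradedSpace.

(** * Permutations of two letters *)

Definition swap2 : 'S_2 := tperm ord0 ord_max.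

Lemma perm2_eq (s : 'S_2) : s = 1%g \/ s = swap2.
Proof.
have two (i : 'I_2) : i = ord0 \/ i = ord_max.
  by case: i => [[|[|//]] i2]; [left | right]; apply: val_inj.
have s01 : s ord0 != s ord_max by rewrite (inj_eq perm_inj).
case: (two (s ord0)) (two (s ord_max)) => s0 [] s1; rewrite ?s0 ?s1 // in s01.
- left; apply/permP => i; rewrite perm1.
  by case: (two i) => ->.
- right; apply/permP => i; case: (two i) => ->; by rewrite ?tpermL ?tpermR.
Qed.

Lemma sum_perm2 (V : nmodType) (P : pred 'S_2) (F : 'S_2 -> V) :
  \sum_(s | P s) F s =
  (if P 1%g then F 1%g else 0) + (if P swap2 then F swap2 else 0).
Proof.
have ne : swap2 != 1%g.
  by apply/eqP => /permP/(_ ord0); rewrite tpermL perm1.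
rewrite big_mkcond (bigD1 (1%g : 'S_2)) //= (bigD1 swap2) //= big1 ?addr0 // => s.
by case: (perm2_eq s) => ->; rewrite eqxx ?andbF.
Qed.

(** * Explicit insertion in low arities *)

Section Insertion.
Variables (K : numFieldType) (E : graded_space K).
Implicit Types (F G : vform E).

Lemma permute1 n (X : n.-tuple E) : permute 1 X = X.
Proof. by apply: eq_from_tnth => i; rewrite tnth_mktuple perm1. Qed.

Lemma permute_swap2 (x y : E) : permute swap2 [tuple x; y] = [tuple y; x].
Proof.
apply: eq_from_tnth => i; rewrite tnth_mktuple.
case: i => [[|[|//]] i2].
- by rewrite (_ : Ordinal i2 = ord0) ?tpermL //; apply: val_inj.
- by rewrite (_ : Ordinal i2 = ord_max) ?tpermR //; apply: val_inj.
Qed.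

Lemma koszul1 n (d : n.-tuple int) : koszul K d 1 = 1.
Proof.
rewrite /koszul big1 // => i _; rewrite big_pred0 // => j.
by rewrite !perm1; case: ltngtP.
Qed.

Lemma koszul_swap2 (d : 2.-tuple int) :
  koszul K d swap2 = (-1) ^ (tnth d ord0 * tnth d ord_max).
Proof.
have e0 : ord0 = 0 :> 'I_2 by apply: val_inj.
have e1 : lift ord0 ord0 = ord_max :> 'I_2 by apply: val_inj.
rewrite /koszul !big_ord_recl big_ord0.
(* Of the four pairs of positions, only (0, 1) meets the inversion condition. *)
do 2![rewrite big_mkcond !big_ord_recl big_ord0] => /=.
by rewrite !e1 !tpermL !tpermR /= !mulr1 mul1r mulrC.
Qed.

Lemma unshuffle1 n k : unshuffle k (1%g : 'S_n).
Proof.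
apply/forallP => i; apply/forallP => j; apply/implyP => /andP[ij _].
by rewrite !perm1.
Qed.

(** The only pair to compare is (0, 1), which [swap2] reverses; this is allowed exactly when the cut
    separates the two positions. *)
Lemma unshuffle_swap2 k : unshuffle k swap2 = (k == 1)%N.
Proof.
apply/idP/eqP => [/forallP/(_ ord0)/forallP/(_ ord_max)|->].
  by rewrite tpermL tpermR /=; case: k => [|[|k]].
apply/forallP => i; apply/forallP => j; apply/implyP => /andP[ij].
by case: i j ij => [[|[|//]] i2] [[|[|//]] j2].
Qed.

Lemma insertion_homog0 F G (d : 0.-tuple int) X :
  insertion_homog F G d X = G [:: F [::]].
Proof.
rewrite /insertion_homog big_ord1 (big_pred1 (1%g : 'S_0)) => [|s].
  by rewrite koszul1 scale1r permute1 tuple0.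
by rewrite (permS0 s) unshuffle1 /= eqxx.
Qed.

Lemma insertion_homog1 F G d (x : E) :
  insertion_homog F G d [tuple x] = G [:: F [::]; x] + G [:: F [:: x]].
Proof.
rewrite /insertion_homog big_ord_recl big_ord1; congr (_ + _).
all: rewrite (big_pred1 (1%g : 'S_1)) => [|s]; last by rewrite (permS1 s) unshuffle1 /= eqxx.
all: by rewrite koszul1 scale1r permute1.
Qed.

(** The summands are sorted by the arity [k] of [F]: one unshuffle for [k] equal to 0 or 2, both
    permutations for [k] equal to 1. *)
Lemma insertion_homog2 F G d (x y : E) :
  insertion_homog F G d [tuple x; y] =
    G [:: F [::]; x; y] +
    (G [:: F [:: x]; y] +
     (-1) ^ (tnth d ord0 * tnth d ord_max) *: G [:: F [:: y]; x]) +
    G [:: F [:: x; y]].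
Proof.
rewrite /insertion_homog !big_ord_recl big_ord0 !sum_perm2.
rewrite !unshuffle1 !unshuffle_swap2 koszul1 koszul_swap2 permute1 permute_swap2 /=.
by rewrite !scale1r !addr0 addrA.
Qed.

Lemma insertion_nil F G : insertion F G [::] = G [:: F [::]].
Proof.
rewrite /insertion (@fsum_support _ _ [:: [tuple]]) // => [|d].
  by rewrite big_seq1 insertion_homog0.
by rewrite (tuple0 d) inE eqxx.
Qed.

Lemma insertion_eq0 F G X :
  (forall s t, (size s + size t)%N = size X -> G (F s :: t) = 0) ->
  insertion F G X = 0.
Proof.
move=> GF0; apply: fsbig1 => d _; apply: big1 => k _; apply: big1 => s _.
rewrite GF0 ?scaler0 // -size_cat cat_take_drop size_tuple //.
Qed.

(** The sum over degrees collapses by linearity of [B], so an insertion can be read off from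
    homogeneous arguments. *)
Lemma insertion1 F G x (B : E -> E) : linear B ->
  (forall i u, piece i u -> G [:: F [::]; u] + G [:: F [:: u]] = B u) ->
  insertion F G [:: x] = B x.
Proof.
move=> linB FGB; rewrite -fsum_hcomp1 //; apply: eq_fsbigr => d _.
rewrite (_ : [tuple _ | _ < _] = [tuple hcomp (tnth d ord0) x]).
  by rewrite insertion_homog1 (FGB (tnth d ord0)) //; apply: hcomp_piece.
by apply: eq_from_tnth => i; rewrite tnth_mktuple !ord1.
Qed.

Lemma insertion2 F G x y (B : E -> E -> E) :
  (forall z, linear (B^~ z)) -> (forall z, linear (B z)) ->
  (forall i j u v, piece i u -> piece j v ->
    G [:: F [::]; u; v] + (G [:: F [:: u]; v] + (-1) ^ (i * j) *: G [:: F [:: v]; u])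
      + G [:: F [:: u; v]] = B u v) ->
  insertion F G [:: x; y] = B x y.
Proof.
move=> linl linr FGB; rewrite -fsum_hcomp2 //; apply: eq_fsbigr => d _.
rewrite (_ : [tuple _ | _ < _] =
  [tuple hcomp (tnth d ord0) x; hcomp (tnth d ord_max) y]).
  by rewrite insertion_homog2; apply: FGB; apply: hcomp_piece.
apply: eq_from_tnth => i; rewrite tnth_mktuple.
case: i => [[|[|//]] i2].
- by rewrite (_ : Ordinal i2 = ord0) //; apply: val_inj.
- by rewrite (_ : Ordinal i2 = ord_max) //; apply: val_inj.
Qed.

End Insertion.

(** * Brackets with an element plus the Euler map *)

Section EulerBracket.
Variables (K : numFieldType) (E : graded_space K).
Implicit Types (F G : vform E) (x y p : E).

Lemma multilinear0 F s t : multilinear F -> F (s ++ 0 :: t) = 0.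
Proof. by move=> /(_ s t (-1) 0 0); rewrite scaler0 addr0 scaleN1r addNr. Qed.

Lemma homogeneous1 i x : piece i x -> homogeneous [tuple i] [tuple x].
Proof. by move=> xi j; rewrite !ord1. Qed.

Lemma homogeneous2 i j x y :
  piece i x -> piece j y -> homogeneous [tuple i; j] [tuple x; y].
Proof. by move=> xi yj [[|[|//]] k2]. Qed.

Lemma has_degree0 m F : has_degree m F -> piece m (F [::]).
Proof. by move=> /(_ 0 [tuple] [tuple]); rewrite big_ord0 add0r; apply=> -[]. Qed.

Lemma has_degree1 m F i x : has_degree m F -> piece i x -> piece (i + m) (F [:: x]).
Proof. by move=> dF xi; have := dF _ _ _ (homogeneous1 xi); rewrite big_ord1. Qed.

Lemma has_degree2 m F i j x y : has_degree m F -> piece i x -> piece j y ->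
  piece (i + j + m) (F [:: x; y]).
Proof.
move=> dF xi yj; have := dF _ _ _ (homogeneous2 xi yj).
by rewrite !big_ord_recl big_ord0 addr0.
Qed.

Lemma graded_symmetric2 F i j x y : graded_symmetric F -> piece i x -> piece j y ->
  F [:: y; x] = (-1) ^ (i * j) *: F [:: x; y].
Proof.
move=> sF xi yj; have := sF _ _ _ swap2 (homogeneous2 xi yj).
by rewrite permute_swap2 koszul_swap2.
Qed.

Lemma sign_sq (n : int) : (-1) ^ n * (-1) ^ n = 1 :> K.
Proof. by rewrite -expfzMl mulrNN mulr1 exp1rz. Qed.

Variable m : int.
Variable F : vform E.
Hypothesis vF : vector_valued_form m F.
Let linF : multilinear F. Proof. by case: vF. Qed.
Let symF : graded_symmetric F. Proof. by case: vF. Qed.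
Let degF : has_degree m F. Proof. by case: vF. Qed.

(** For [x] of degree [i], the value [F [:: x]] has degree [i + m], and [- i + (i + m) = m]. *)
Lemma euler_form1 x : F [:: euler x] - euler (F [:: x]) = m%:~R *: F [:: x].
Proof.
have F1 : linear (fun x => F [:: x]) by move=> a u v; apply: (linF [::] [::]).
elim/graded_ind: x => [|x y hx hy|i x xi].
- by rewrite !(linear_at0 (@euler_linear K E), linear_at0 F1) subr0 scaler0.
- rewrite !(linear_atD _ _ (@euler_linear K E), linear_atD _ _ F1) scalerDr -hx -hy.
  by rewrite opprD addrACA.
- rewrite (euler_homog xi) (euler_homog (has_degree1 degF xi)).
  (* Linearity is stated for [a *: u + v], so a zero summand is added to apply it to a multiple of
     [x]. *)
  rewrite -[_ *: x]addr0 F1 (linear_at0 F1) addr0 -scalerBl opprK intrD.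
  by rewrite addKr.
Qed.

Lemma bilinear_form2l y : linear (fun x => F [:: x; y]).
Proof. by move=> a u v; apply: (linF [::] [:: y]). Qed.

Lemma bilinear_form2r x : linear (fun y => F [:: x; y]).
Proof. by move=> a u v; apply: (linF [:: x] [::]). Qed.

(** Bilinearity reduces to arguments of degrees [i] and [j], where the factor is
    [- i - j + (i + j + m) = m]. *)
Lemma euler_form2 x y :
  F [:: euler x; y] + F [:: x; euler y] - euler (F [:: x; y]) = m%:~R *: F [:: x; y].
Proof.
have eD u v := linear_atD u v (@euler_linear K E).
have e0 := linear_at0 (@euler_linear K E).
have lD z u v := linear_atD u v (bilinear_form2l z).
have rD z u v := linear_atD u v (bilinear_form2r z).
have l0 z := linear_at0 (bilinear_form2l z).
have r0 z := linear_at0 (bilinear_form2r z).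
elim/graded_ind: x => [|x x' hx hx'|i x xi].
- by rewrite e0 !l0 e0 addr0 subr0 scaler0.
- rewrite eD !lD eD scalerDr -hx -hx' opprD.
  by rewrite [RHS]addrACA; congr (_ + _); rewrite addrACA.
elim/graded_ind: y => [|y y' hy hy'|j y yj].
- by rewrite e0 !r0 e0 addr0 subr0 scaler0.
- rewrite eD !rD eD scalerDr -hy -hy' opprD.
  by rewrite [RHS]addrACA; congr (_ + _); rewrite addrACA.
rewrite (euler_homog xi) (euler_homog yj) (euler_homog (has_degree2 degF xi yj)).
rewrite -[_ *: x]addr0 -[_ *: y]addr0 bilinear_form2l bilinear_form2r.
rewrite l0 r0 !addr0 -scalerDl -scalerBl opprK !intrD -opprD.
by rewrite addKr.
Qed.

(* The bracket formula holds in all arities; this bound keeps the unshuffles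
   that occur within 'S_2. *)
Hypothesis F_ge3 : forall s, (2 < size s)%N -> F s = 0.

(** Inserting [p + S] into [F] gives [F (p :: s)] plus the sum of [F] with [S] applied in one slot;
    inserting [F] into [p + S] gives [S (F s)], since the constant [p] accepts no argument. The [S]
    terms differ by [m] times [F s]. *)
Lemma RN_bracket_euler p : piece 0 p ->
  RN_bracket 0 m (form0 p \+ form1 (@euler K E)) F
    =1 fun s => F (p :: s) + m%:~R *: F s.
Proof.
move=> p0 s; rewrite /RN_bracket /= mul0r expr0z scale1r.
have e0 := linear_at0 (@euler_linear K E).
have F0 (t : seq E) : F (0 :: t) = 0 by apply: (multilinear0 [::]).
case: s => [|x [|y [|z s]]].
- rewrite !insertion_nil /= addr0 add0r (euler_homog (has_degree0 degF)).
  by rewrite scaleNr opprK.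
- rewrite (@insertion1 K E _ _ _ (fun x => F [:: p; x] + F [:: euler x])).
  + rewrite (@insertion1 K E _ _ _ (fun x => euler (F [:: x]))).
    * by rewrite -addrA euler_form1.
    * by move=> a u v; rewrite (linF [::] [::]) euler_linear.
    * by move=> i u _ /=; rewrite !add0r.
  + move=> a u v; rewrite (linF [:: p] [::]) euler_linear (linF [::] [::]).
    by rewrite scalerDr addrACA.
  + by move=> i u _ /=; rewrite addr0 add0r.
- rewrite (@insertion2 K E _ _ _ _ (fun x y =>
    F [:: p; x; y] + (F [:: euler x; y] + F [:: x; euler y]))).
  + rewrite (@insertion2 K E _ _ _ _ (fun x y => euler (F [:: x; y]))).
    * by rewrite -addrA euler_form2.
    * by move=> v a u u'; rewrite bilinear_form2l euler_linear.
    * by move=> v a u u'; rewrite bilinear_form2r euler_linear.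
    * by move=> i j u v _ _ /=; rewrite !addr0 scaler0 !add0r.
  + move=> v a u u'; rewrite (linF [:: p] [:: v]) bilinear_form2l euler_linear.
    by rewrite bilinear_form2l !scalerDr [RHS]addrACA; congr (_ + _); rewrite addrACA.
  + move=> v a u u'; rewrite (linF [:: p; v] [::]) bilinear_form2r euler_linear.
    by rewrite bilinear_form2r !scalerDr [RHS]addrACA; congr (_ + _); rewrite addrACA.
  + move=> i j u v ui vj /=; rewrite !addr0 !add0r F0 addr0.
    (* The Koszul sign of the swap cancels against graded symmetry, because [euler v] keeps the
       degree of [v]. *)
    by rewrite (graded_symmetric2 symF ui (euler_piece vj))
      scalerA sign_sq scale1r.
(* From arity three on everything vanishes: [p + S] consumes at most one argument, leaving [F] at
   least three entries; conversely [S] accepts one entry only, so [F] would have to consume all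
   arguments. *)
- rewrite !F_ge3 // scaler0 addr0.
  rewrite (insertion_eq0 (F := F)) => [|t u tu]; last first.
    case: u tu => [|v u] tu /=; last by rewrite addr0.
    by rewrite add0r F_ge3 ?e0 // -[size t]addn0 tu.
  rewrite subr0; apply: insertion_eq0 => t u tu.
  case: t tu => [|v [|w t]] tu; last by rewrite /= addr0 F0.
    by move: tu; rewrite /= add0n => u3; rewrite F_ge3 //= u3.
  by move: tu; rewrite /= add1n => -[u2]; rewrite F_ge3 //= u2.
Qed.
End EulerBracket.

(** * Curved structures as forms, and their twists *)

Section CurvedForm.
Variables (K : numFieldType) (E : graded_space K).
Variables (C : E) (l1 : E -> E) (l2 : E -> E -> E).

Lemma curved_form0E : curved_form C l1 l2 [::] = C.
Proof. by rewrite /curved_form /= !addr0. Qed.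

Lemma curved_form1E x : curved_form C l1 l2 [:: x] = l1 x.
Proof. by rewrite /curved_form /= addr0 add0r. Qed.

Lemma curved_form2E x y : curved_form C l1 l2 [:: x; y] = l2 x y.
Proof. by rewrite /curved_form /= !add0r. Qed.

Lemma curved_form_ge3 s : (2 < size s)%N -> curved_form C l1 l2 s = 0.
Proof. by case: s => [|x [|y [|z s]]] // _; rewrite /curved_form /= !addr0. Qed.

Definition curved_formE := (curved_form0E, curved_form1E, curved_form2E).

(** The degree [m] is left free: it is 1 for the structures and 0 for [N] and [Q]. *)
Lemma curved_form_vector_valued m :
  piece m C ->
  linear l1 -> (forall i x, piece i x -> piece (i + m) (l1 x)) ->
  (forall z, linear (l2^~ z)) -> (forall z, linear (l2 z)) ->
  (forall i j x y, piece i x -> piece j y ->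
    l2 x y = (-1) ^ (i * j) *: l2 y x) ->
  (forall i j x y, piece i x -> piece j y -> piece (i + j + m) (l2 x y)) ->
  vector_valued_form m (curved_form C l1 l2).
Proof.
move=> Cm lin1 deg1 linl linr sym deg2; split.
- move=> s t a x y; case: s => [|u [|v s]] /=.
  + case: t => [|v [|w t]]; rewrite ?curved_formE //; [exact: lin1 | exact: linl |].
    by rewrite !curved_form_ge3 // scaler0 addr0.
  + case: t => [|v t]; rewrite ?curved_formE; first exact: linr.
    by rewrite !curved_form_ge3 // scaler0 addr0.
  + rewrite !curved_form_ge3 ?scaler0 ?addr0 //= size_cat /= addnS //.
- move=> [|[|[|n]]] d X s dX.
  + by rewrite (permS0 s) permute1 koszul1 scale1r.
  + by rewrite (permS1 s) permute1 koszul1 scale1r.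
  + case: (perm2_eq s) => ->; first by rewrite permute1 koszul1 scale1r.
    case/tupleP: X dX => x X; case/tupleP: X => y X; rewrite (tuple0 X) => dX.
    rewrite (_ : [tuple of _] = [tuple x; y]); last exact: val_inj.
    rewrite permute_swap2 koszul_swap2 !curved_form2E mulrC.
    exact: sym (dX ord_max) (dX ord0).
  + by rewrite !curved_form_ge3 ?size_tuple // scaler0.
- move=> [|[|[|n]]] d X dX.
  + by rewrite (tuple0 X) big_ord0 add0r curved_form0E.
  + case/tupleP: X dX => x X; rewrite (tuple0 X) => dX.
    by rewrite big_ord1 curved_form1E; apply: deg1 (dX ord0).
  + case/tupleP: X dX => x X; case/tupleP: X => y X; rewrite (tuple0 X) => dX.
    rewrite big_ord_recl big_ord1 curved_form2E.
    by apply: deg2 (dX ord0) _; apply: (dX (lift ord0 ord0)).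
  + by rewrite curved_form_ge3 ?size_tuple //; apply: piece_zero.
Qed.

Hypothesis mu : curved_sdgla C l1 l2.
Variable p : E.
Hypothesis p0 : piece 0 p.

(** The derivation rule at [(p, p)] leaves two terms, equal because [p] has degree 0. *)
Lemma poisson_l2_l1 : l2 p p = 0 -> l2 p (l1 p) = 0.
Proof.
move=> pp; have l10 : l1 0 = 0 by apply: linear_at0; apply: l1_linear mu.
have := l1_derivation mu p0 p0; rewrite pp l10 add0r expr0z scale1r.
rewrite (l2_symmetric mu (l1_degree mu p0) p0) mulr0 expr0z scale1r.
by rewrite -mulr2n -scaler_nat => /eqP; rewrite scaler_eq0 pnatr_eq0 => /eqP.
Qed.

(** In the Jacobi identity at [(p, p, x)] the first term dies and the other two coincide, again
    because [p] has degree 0. *)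
Lemma poisson_l2_l2 i x : piece i x -> l2 p p = 0 -> l2 p (l2 p x) = 0.
Proof.
move=> xi pp; have l20 : l2 0 x = 0.
  by apply: (@linear_at0 _ _ (l2^~ x)) => a u v; apply: (l2_linear_l mu).
have := l2_jacobi mu p0 p0 xi; rewrite pp l20 add0r !mul0r expr0z !scale1r.
rewrite (l2_symmetric mu (l2_degree mu p0 xi) p0) mulr0 expr0z scale1r.
by rewrite -mulr2n -scaler_nat => /eqP; rewrite scaler_eq0 pnatr_eq0 => /eqP.
Qed.

(** Each twisted axiom expands into original axioms, some with [p] as an argument, and terms killed
    by the Poisson condition. *)
Lemma curved_sdgla_twist : l2 p p = 0 ->
  curved_sdgla (C + l1 p) (l1 \+ l2 p) l2.
Proof.
move=> pp; have l1D u v := @linear_atD _ _ l1 u v (l1_linear mu).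
have l2D z u v : l2 (u + v) z = l2 u z + l2 v z.
  by apply: (@linear_atD _ _ (l2^~ z)) => a x y; apply: (l2_linear_l mu).
have r2D z u v : l2 z (u + v) = l2 z u + l2 z v.
  by apply: (@linear_atD _ _ (l2 z)) => a x y; apply: (l2_linear_r mu).
have lp i x : piece i x -> piece (i + 1) (l2 p x).
  by move=> xi; have := l2_degree mu p0 xi; rewrite add0r.
have derp i x : piece i x -> l1 (l2 p x) + l2 (l1 p) x + l2 p (l1 x) = 0.
  by move=> xi; have := l1_derivation mu p0 xi; rewrite expr0z scale1r.
split=> /=.
- apply: pieceD (curvature_degree mu) _.
  by have := l1_degree mu p0; rewrite add0r.
- by move=> a x y; rewrite (l1_linear mu) (l2_linear_r mu) scalerDr addrACA.
- by move=> i x xi; apply: pieceD; [apply: l1_degree mu _ _ xi | apply: lp].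
- exact: l2_linear_l mu.
- exact: l2_linear_r mu.
- exact: l2_symmetric mu.
- exact: l2_degree mu.
(* What remains is [l1 (l1 p) + l2 p C], the square axiom at [p] up to a swap without sign. *)
- rewrite l1D r2D (l1_curvature mu) add0r poisson_l2_l1 // addr0.
  rewrite (l2_symmetric mu p0 (curvature_degree mu)) mul0r expr0z scale1r.
  by rewrite addrC (l1_square mu p0).
(* The sum splits into the square axiom at [x], the derivation rule at [(p, x)] and
   [l2 p (l2 p x)]. *)
- move=> i x xi; rewrite l1D l2D r2D (poisson_l2_l2 xi pp) addr0.
  rewrite -!addrA [l2 (l1 p) x + _]addrCA !addrA (l1_square mu xi) add0r.
  by rewrite [l2 (l1 p) x + _]addrC; apply: (derp i).
(* The [l1] terms form the original derivation rule; the others form the Jacobi identity at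
   [(p, x, y)], where the signs [(-1) ^ (i * j)] and [(-1) ^ ((j + 1) * i)] multiply to
   [(-1) ^ i]. *)
- move=> i j x y xi yj; rewrite l2D r2D scalerDr.
  rewrite (addrACA (l1 _)) [LHS]addrACA (l1_derivation mu xi yj) add0r.
  have := l2_jacobi mu p0 xi yj; rewrite mul0r expr0z scale1r.
  rewrite (l2_symmetric mu (lp _ _ yj) xi) scalerA mulrDl mul1r.
  rewrite expfzDr ?oppr_eq0 ?oner_eq0 // [j * i]mulrC mulrA sign_sq mul1r.
  rewrite (l2_symmetric mu (l2_degree mu xi yj) p0) mulr0 expr0z scale1r.
  by move=> jac; rewrite -addrA addrC.
- exact: l2_jacobi mu.
Qed.

End CurvedForm.

(** * The equivalence and the deformed structure *)

Theorem proposition2p9 (R : realType) (b : base_field)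
    (E : graded_space (scalars R b))
    (C : E) (l1 : E -> E) (l2 : E -> E -> E) (p : E)
    (mu_curved : curved_sdgla C l1 l2) (p_degree : piece 0 p) :
  let mu := curved_form C l1 l2 in
  let S := @euler (scalars R b) E in
  let N := form0 p \+ form1 S in
  let Q := form0 (2 *: p) \+ form1 S in
  ((nijenhuis_with_square mu N Q /\ form_curvature N = p)
     <-> poisson_element l2 p) /\
  (poisson_element l2 p ->
     RN_bracket 0 1 N mu =1 curved_form (C + l1 p) (l1 \+ l2 p) l2 /\
     curved_sdgla (C + l1 p) (l1 \+ l2 p) l2).
Proof.
move=> mu S N Q.
have linl z : linear (l2^~ z) by move=> a x y; apply: (l2_linear_l mu_curved).
have linr z : linear (l2 z) by move=> a x y; apply: (l2_linear_r mu_curved).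
have vmu : vector_valued_form 1 mu.
  by apply: curved_form_vector_valued => //; case: (mu_curved).
pose mu' := curved_form (C + l1 p) (l1 \+ l2 p) l2.
(* The second bracket with [N] is computed before the Poisson condition is known, so this is shown
   for every [p] of degree 0. *)
have vmu' : vector_valued_form 1 mu'.
  case: mu_curved => C1 lin1 deg1 _ _ sym deg2 _ _ _ _.
  apply: curved_form_vector_valued => // [|a x y|i x xi].
  - by apply: pieceD C1 _; have := deg1 _ _ p_degree; rewrite add0r.
  - by rewrite /= lin1 linr scalerDr addrACA.
  - by apply: pieceD; [apply: deg1|have := deg2 _ _ _ _ p_degree xi; rewrite add0r].
have vN q : piece 0 q -> vector_valued_form 0 (form0 q \+ form1 S).
  (* The form is read as a curved form with zero binary part. *)
  move=> q0; rewrite (_ : _ \+ _ = curved_form q S (fun _ _ => 0)); last first.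
    by apply/funext => -[|x [|y [|z s]]];
      rewrite ?curved_formE ?curved_form_ge3 //= !(addr0, add0r).
  apply: curved_form_vector_valued => //; first exact: euler_linear.
  - by move=> i x; rewrite addr0; apply: euler_piece.
  - by move=> z a x y; rewrite scaler0 addr0.
  - by move=> z a x y; rewrite scaler0 addr0.
  - by move=> *; rewrite scaler0.
  - by move=> *; apply: piece_zero.
have q_degree : piece 0 (2 *: p) by apply: pieceZ.
(* The Euler part returns [mu], of degree 1; inserting [p] lowers arities by one, so [l1 p] joins
   [C] and [l2 p] joins [l1]. *)
have Nmu : RN_bracket 0 1 N mu = mu'.
  apply/funext => s; rewrite (RN_bracket_euler vmu) //; last exact: curved_form_ge3.
  rewrite scale1r /mu /mu'; case: s => [|x [|y [|z s]]]; rewrite ?curved_formE //=.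
  - by rewrite addrC.
  - by rewrite addrC.
  - by rewrite curved_form_ge3 // add0r.
  - by rewrite !curved_form_ge3 // addr0.
have Nmu' s : RN_bracket 0 1 N mu' s = mu' (p :: s) + mu' s.
  by rewrite (RN_bracket_euler vmu') ?scale1r //; apply: curved_form_ge3.
have Qmu s : RN_bracket 0 1 Q mu s = mu (2 *: p :: s) + mu s.
  by rewrite (RN_bracket_euler vmu) ?scale1r //; apply: curved_form_ge3.
have two (B : E -> E) : linear B -> B (2 *: p) = B p + B p.
  by move=> linB; rewrite scaler_nat mulr2n linear_atD.
have lin1 : linear l1 by apply: (l1_linear mu_curved).
(* Only the curvature components of [N, [N, mu]] and [Q, mu] can differ. *)
have sq0 : RN_bracket 0 1 N mu' [::] = RN_bracket 0 1 Q mu [::] + l2 p p.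
  rewrite Nmu' Qmu /mu /mu' !curved_formE (two l1) //= (addrC C) addrA [RHS]addrAC.
  by congr (_ + _); apply: addrAC.
split; last by case=> _ pp; split; [rewrite Nmu | apply: curved_sdgla_twist].
split=> [[[_ _ _ sq _] _]|[_ pp]].
  (* Evaluation at the empty sequence isolates the defect [l2 p p]. *)
  split=> //; move: (sq [::]); rewrite Nmu sq0 => /eqP.
  by rewrite -subr_eq0 addrAC subrr add0r => /eqP.
split; last by rewrite /form_curvature /N /= addr0.
split=> //; [exact: vN | exact: vN | |].
- move=> s; rewrite Nmu; case: s => [|x [|y [|z s]]].
  + by rewrite sq0 pp addr0.
  (* Both sides are [l1 x] plus twice [l2 p x]. *)
  + rewrite Nmu' Qmu /mu /mu' !curved_formE /= (two (l2^~ x)) // -addrA.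
    by congr (_ + _); rewrite addrC.
  + by rewrite Nmu' Qmu /mu /mu' !curved_formE !curved_form_ge3.
  + by rewrite Nmu' Qmu /mu /mu' !curved_form_ge3.
- move=> s; rewrite (RN_bracket_euler (vN _ q_degree)) //.
  (* [Q] has degree 0, so only [Q (p :: s)] is left; for empty [s] it is [S p], zero because [p] has
     degree 0. *)
  + rewrite scale0r addr0; case: s => [|x s] /=; last by rewrite addr0.
    by rewrite add0r /S (euler_homog p_degree) oppr0 scale0r.
  + by move=> [|x [|y t]] //= _; rewrite addr0.
Qed.
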